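(* Let $\mathcal M$ be the space of symmetric positive definite (real, of fixed size) matrices with the Fisher-Rao (affine-invariant) metric. Let $u_i,u_{i-1}\in\mathcal M$, let $z\in T_{u_i}\mathcal M$ and $v\in T_{u_{i-1}}\mathcal M$ (symmetric matrices), and consider the vector field $B_t=\mathrm{pt}_{u_i,\exp_{u_{i-1}}(tv)}z$ along the geodesic $t\mapsto\exp_{u_{i-1}}(tv)$. Put $$\bar u_{i-1}=u_i^{-1/2}u_{i-1}u_i^{-1/2},\qquad \bar z=u_i^{-1/2}zu_i^{-1/2},\qquad \bar v=u_i^{-1/2}vu_i^{-1/2}.$$ Let $X$ be the solution of the Sylvester equation $\bar u_{i-1}^{1/2}X+X\bar u_{i-1}^{1/2}=\bar v$ and set $$S=v\,u_{i-1}^{-1}\,u_i^{1/2}\,\bar u_{i-1}^{1/2}\,\bar z\,\bar u_{i-1}^{1/2}\,u_i^{1/2},\qquad T=u_i^{1/2}\,X\,\bar z\,\bar u_{i-1}^{1/2}\,u_i^{1/2}.$$ Then the covariant derivative of $B_t$ at $t=0$ (a tangent vector at $u_{i-1}$) is $$\frac{D}{dt}\Big|_{t=0}B_t=\big(T-\tfrac12S\big)+\big(T-\tfrac12S\big)^\top.$$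
   Context: The Fisher-Rao metric on symmetric positive definite matrices is (up to a constant factor) $\langle A,B\rangle_P=\mathrm{trace}(P^{-1}AP^{-1}B)$ for symmetric matrices $A,B\in T_P\mathcal M$. $\mathrm{pt}_{a,b}$ is parallel transport from $a$ to $b$ along the (unique) geodesic connecting $a$ and $b$; $\exp$ is the Riemannian exponential map; $\tfrac{D}{dt}$ is the covariant derivative (Levi-Civita connection) along the curve. $A^{1/2}$ is the symmetric positive definite square root and $A^{-1/2}$ its inverse; $^\top$ denotes the transpose. In the paper $v=v_n$ is an element of an orthonormal basis of $T_{u_{i-1}}\mathcal M$, $B_t=B^n_t$, and $z=\log_{u_i}y_i$ for some $y_i\in\mathcal M$ (on this manifold every tangent vector at $u_i$ is of this form). *)

(* Defs.v *)
From HB Require Import structures.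
From mathcomp Require Import all_boot all_order all_algebra.
From mathcomp Require Import boolp classical_sets reals topology normedtype derive.

Set Implicit Arguments.
Unset Strict Implicit.
Unset Printing Implicit Defensive.

Import Order.TTheory GRing.Theory Num.Theory.
Import numFieldNormedType.Exports.

Local Open Scope classical_set_scope.
Local Open Scope ring_scope.

Section AffineInvariantSPD.
Context {R : realType} {n : nat}.
Implicit Types (P Q A B C a b p v z : 'M[R]_n) (t : R).

Definition sym A : Prop := A^T = A.

Definition spd P : Prop :=
  sym P /\ forall x : 'cV[R]_n, x != 0 -> 0 < (x^T *m P *m x) 0 0.

(* Well defined because a symmetric positive definite matrix has exactly one
   symmetric positive definite square root. *)
Definition sqrtmx A : 'M[R]_n := xget 0 [set B | spd B /\ B *m B = A].

Definition fisher_rao P A B : R := \tr (invmx P *m A *m invmx P *m B).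

(* The symmetric positive definite matrices form an open subset of the vector
   space of symmetric matrices, so that every tangent space is the space of
   symmetric matrices, and every affine connection has the form
   (nabla_A Y)(P) = 'D_A Y P + Gam P A (Y P) with Gam P bilinear on symmetric
   matrices.  As constant fields commute, nabla is torsion free iff Gam P is
   symmetric; it is compatible with the metric iff the product rule holds for
   the inner product of any two constant fields B and C.
   Only the values of Gam at spd points and symmetric arguments matter. *)
Definition levi_civita (Gam : 'M[R]_n -> 'M[R]_n -> 'M[R]_n -> 'M[R]_n) : Prop :=
  forall P, spd P ->
  [/\ forall A B, sym A -> sym B -> sym (Gam P A B),
      forall k A B C, sym A -> sym B -> sym C ->
        Gam P (k *: A + B) C = k *: Gam P A C + Gam P B C,
      forall A B, sym A -> sym B -> Gam P A B = Gam P B A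
    & forall A B C, sym A -> sym B -> sym C ->
        is_derive P A (fun Q => fisher_rao Q B C)
          (fisher_rao P (Gam P A B) C + fisher_rao P B (Gam P A C))].

Definition christoffel : 'M[R]_n -> 'M[R]_n -> 'M[R]_n -> 'M[R]_n :=
  xget (fun _ _ _ => 0) levi_civita.

(* D/dt of the vector field V along the curve c *)
Definition covderiv (c V : R -> 'M[R]_n) t : 'M[R]_n :=
  derive1 V t + christoffel (c t) (derive1 c t) (V t).

Definition parallel_along (c V : R -> 'M[R]_n) : Prop :=
  forall t, [/\ sym (V t), derivable V t 1 & covderiv c V t = 0].

(* Geodesics are parametrised by all of R: the manifold is complete. *)
Definition geodesic (c : R -> 'M[R]_n) : Prop :=
  (forall t, spd (c t) /\ derivable c t 1) /\ parallel_along c (derive1 c).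

Definition geodesic_from p v : R -> 'M[R]_n :=
  xget (fun _ => 0) [set c | [/\ geodesic c, c 0 = p & derive1 c 0 = v]].

Definition riem_exp p v : 'M[R]_n := geodesic_from p v 1.

Definition geodesic_between a b : R -> 'M[R]_n :=
  xget (fun _ => 0) [set c | [/\ geodesic c, c 0 = a & c 1 = b]].

Definition parallel_field (c : R -> 'M[R]_n) z : R -> 'M[R]_n :=
  xget (fun _ => 0) [set V | parallel_along c V /\ V 0 = z].

Definition par_transport a b z : 'M[R]_n :=
  parallel_field (geodesic_between a b) z 1.

End AffineInvariantSPD.

(* Main.v *)
Require Import Defs.
From HB Require Import structures.
From mathcomp Require Import all_boot all_order all_algebra.
From mathcomp Require Import boolp classical_sets reals topology normedtype derive.
From mathcomp Require Import functions sequences realfun exp.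
From mathcomp Require Import complex ring lra.

Set Implicit Arguments.
Unset Strict Implicit.
Unset Printing Implicit Defensive.

Import Order.TTheory GRing.Theory Num.Theory.
Import numFieldNormedType.Exports.

Local Open Scope ring_scope.

(** The metric is homogeneous enough for every object of the statement to have a
   closed form, after which the claim is an exercise in the product rule.

   The Christoffel symbol of the metric is
   [Gam P A B = - (A *m P^-1 *m B + B *m P^-1 *m A) / 2]: it satisfies the axioms
   of the Levi-Civita connection ([affine_gammaP]) and the Koszul argument shows
   that nothing else does ([levi_civita_unique]). Geodesics therefore solve
   [c'' = c' *m c^-1 *m c'], that is, [c^-1 *m c'] is constant, and the linear
   equation so obtained gives [c t = s *m exp (t W) *m s] where [s] is the square
   root of [c 0] and [W] is symmetric ([geodesicE]). Along this curve the parallel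
   fields are [s *m exp (t W / 2) *m z0 *m exp (t W / 2) *m s] ([parallel_geoE]).
   At time 1 the factor [exp (W / 2)] is the square root of
   [exp W = s^-1 *m b *m s^-1] for [b = c 1], so that parallel transport from [a]
   to [b] is conjugation by this square root between two conjugations by the
   square root [s] of [a] ([par_transportE]).

   For the field [B] of the theorem this gives [B t = s *m r t *m zbar *m r t *m s]
   where [r t] is the square root of [s^-1 *m gam t *m s^-1]. The derivative of the
   square root solves the Sylvester equation obtained by differentiating
   [r t *m r t], hence it is [X] ([is_derive_sqrtmx]); differentiability comes from
   the coercivity of the Sylvester operator ([sylvester_bound]). The product rule
   then contributes [T + T^T], and the Christoffel term contributes
   [- (S + S^T) / 2] because [S = v *m u'^-1 *m B 0].

   The exponential flow and the square root are both built on the spectral theorem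
   for real symmetric matrices ([real_spectral]). *)

(** * The spectral theorem for real symmetric matrices *)

(** A real symmetric matrix is Hermitian over the complex numbers, where a spectral
   decomposition with real eigenvalues is available; a real number that is an
   eigenvalue over the complex numbers is already one over the reals. *)
Lemma sym_eigenvalue (R : realType) (n : nat) (A : 'M[R]_n.+1) :
  sym A -> exists a, eigenvalue A a.
Proof.
move=> symA; pose Ac := map_mx (real_complex R) A.
have hermA : Ac \is hermsymmx.
  apply: realsym_hermsym.
    by apply/is_hermitianmxP; rewrite expr0 scale1r map_mx_id // map_trmx symA.
  by apply/mxOverP => i j; rewrite mxE; apply/complex_realP; exists (A i j).
have /orthomx_spectralP := hermitian_normalmx hermA.
have /mxOverP/(_ 0 0)/complex_realP[a] := hermitian_spectral_diag_real hermA.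
have := spectral_unit Ac.
move: (spectralmx Ac) (spectral_diag Ac) => P d Pu da AE.
exists a; rewrite -(eigenvalue_map (real_complex R)).
apply/eigenvalueP; exists (row 0 P).
  rewrite -row_mul -/Ac AE -mulmxA mulKVmx // row_mul row_diag_mx -scalemxAl.
  by rewrite -rowE da.
apply/eqP => P0; have /eqP[] := oner_neq0 (R[i]%C).
have <- : (P *m invmx P) 0 0 = 1 by rewrite mulmxV // mxE.
rewrite mxE big1 // => j _.
by move/matrixP: P0 => /(_ 0 j); rewrite !mxE => ->; rewrite mul0r.
Qed.

(** The Householder reflection in the bisector of [v] and the first basis vector
   swaps the two, so it is an orthogonal completion of [v] in closed form. *)
Lemma exists_reflection (R : realType) (n : nat) (v : 'rV[R]_n.+1) :
  v *m v^T = 1 ->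
  exists2 H : 'M[R]_n.+1, H^T = H /\ H *m H = 1%:M & row 0 H = v.
Proof.
move=> v1; pose e : 'rV[R]_n.+1 := delta_mx 0 0.
pose w := v - e; pose k : R := (w *m w^T) 0 0.
have kE : w *m w^T = k%:M by exact: mx11_scalar.
have e1 : e *m e^T = 1.
  by apply/matrixP => i j; rewrite /e trmx_delta mul_delta_mx !ord1 !mxE.
have [k0|kn0] := eqVneq k 0.
  (* A reflection is only defined by a nonzero vector; if [w] vanishes, [v] is the
     first basis vector and the identity will do. *)
  have -> : v = e.
    apply/eqP; rewrite -subr_eq0; apply/eqP/matrixP => i j.
    move/eqP: k0; rewrite /k mxE psumr_eq0 => [/allP/(_ j)|l _]; last first.
      by rewrite [_^T _ _]mxE -expr2 sqr_ge0.
    rewrite mem_index_enum [_^T _ _]mxE -expr2 sqrf_eq0 => /(_ isT)/eqP.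
    by rewrite ord1 -/w => ->; rewrite mxE.
  exists 1%:M; first by rewrite trmx1 mul1mx.
  by rewrite row1.
pose q := (2 / k) *: (w^T *m w).
have qq : q *m q = q + q.
  rewrite /q -scalemxAl -scalemxAr mulmxA -[_ *m w *m _]mulmxA kE mul_mx_scalar.
  by rewrite -scalemxAl !scalerA -scalerDl; congr (_ *: _); field.
exists (1%:M - q).
  split; first by rewrite /q linearB linearZ /= trmx_mul trmxK trmx1.
  by rewrite mulmxBl mul1mx mulmxBr mulmx1 qq (opprD q q) addNKr opprK subrK.
rewrite rowE -/e mulmxBr mulmx1 /q -scalemxAr mulmxA.
have -> : e *m w^T = (- (k / 2))%:M.
  have vw : v *m w^T = - (e *m w^T).
    rewrite /w linearB /= !mulmxBr v1 e1 opprB; congr (_ - _).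
    have : (v *m e^T)^T = v *m e^T.
      by rewrite [v *m e^T]mx11_scalar tr_scalar_mx.
    by rewrite trmx_mul trmxK => ->.
  move: kE; rewrite {1}/w mulmxBl vw -opprD -mulr2n => /eqP; rewrite eqr_oppLR => /eqP kE.
  have -> : e *m w^T = 2^-1 *: (e *m w^T *+ 2).
    by rewrite -[e *m w^T *+ 2]scaler_nat scalerA mulVf ?scale1r // pnatr_eq0.
  by rewrite kE -raddfN scale_scalar_mx; congr _%:M; rewrite mulrN mulrC.
rewrite mul_scalar_mx scalerA (_ : 2 / k * _ = - 1); last by field.
by rewrite scaleN1r opprK addrC subrK.
Qed.

(** By induction on the size: conjugation by the reflection that carries the first
   basis vector to a unit eigenvector splits off a block of size one, and symmetry
   kills the first column together with the first row. *)
Theorem real_spectral (R : realType) (n : nat) (A : 'M[R]_n) : sym A ->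
  exists Q : 'M[R]_n, exists2 d : 'rV[R]_n,
    Q *m Q^T = 1%:M & A = Q^T *m diag_mx d *m Q.
Proof.
elim: n A => [|n IHn] A symA.
  by exists 1%:M, 0; rewrite ?flatmx0 // [LHS]flatmx0 [RHS]flatmx0.
have [a /eigenvalueP[v0 v0A v0n0]] := sym_eigenvalue symA.
pose k := (v0 *m v0^T) 0 0.
have kgt0 : 0 < k.
  rewrite /k mxE lt0r psumr_neq0 ?sumr_ge0 //=; last 2 first.
  - by move=> i _; rewrite mxE -expr2 sqr_ge0.
  - by move=> i _; rewrite mxE -expr2 sqr_ge0.
  rewrite andbT; have [j vj] := rV0Pn _ v0n0.
  apply/hasP; exists j; first by rewrite mem_index_enum.
  by rewrite [_^T _ _]mxE -expr2 exprn_even_gt0.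
pose v := (Num.sqrt k)^-1 *: v0.
have vA : v *m A = a *: v by rewrite -scalemxAl v0A !scalerA mulrC.
have v1 : v *m v^T = 1.
  rewrite linearZ /= -scalemxAl -scalemxAr scalerA [v0 *m _]mx11_scalar -/k.
  rewrite scale_scalar_mx -invfM -expr2 sqr_sqrtr ?ltW // mulVf //.
  exact: lt0r_neq0.
have [H [HT HH] Hv] := exists_reflection v1.
pose B : 'M[R]_(1 + n) := H *m A *m H.
have symB : B^T = B by rewrite /B !trmx_mul HT symA mulmxA.
have B0 : row 0 B = a *: row 0 1%:M.
  by rewrite /B !row_mul Hv vA -scalemxAl -Hv -row_mul HH.
have HBH : A = H *m B *m H.
  by rewrite /B !mulmxA HH mul1mx -mulmxA HH mulmx1.
move: B symB B0 HBH => B symB B0 HBH.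
have B0E j : B 0 j = a * (0 == j)%:R.
  by move/rowP: B0 => /(_ j); rewrite !mxE.
have BE : B = block_mx a%:M 0 0 (drsubmx B).
  have l0 (i : 'I_1) : lshift n i = 0 by apply/val_inj; rewrite /= ord1.
  have r0 (i : 'I_n) : (0 == rshift 1 i) = false by rewrite -val_eqE.
  rewrite -[LHS]submxK; congr block_mx; apply/matrixP => i j; rewrite !mxE.
  - by rewrite !l0 B0E !ord1 eqxx mulr1 mulr1n.
  - by rewrite l0 B0E r0 mulr0.
  - by rewrite -[B in LHS]symB mxE l0 B0E r0 mulr0.
have /IHn[Q' [d' Q'1 B'E]] : sym (drsubmx B).
  by rewrite /sym trmx_drsub symB.
pose Q : 'M[R]_(1 + n) := block_mx 1%:M 0 0 Q'.
have QQ : Q *m Q^T = 1%:M.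
  rewrite /Q tr_block_mx mulmx_block !(mulmx0, mul0mx, trmx0, addr0, add0r).
  by rewrite trmx1 mulmx1 Q'1 -scalar_mx_block.
exists (Q *m H), (row_mx a%:M d').
  by rewrite trmx_mul HT mulmxA -[Q *m H *m H]mulmxA HH mulmx1.
have BQ : B = Q^T *m diag_mx (row_mx a%:M d') *m Q.
  rewrite BE B'E diag_mx_row /Q tr_block_mx !mulmx_block.
  rewrite !(mulmx0, mul0mx, trmx0, addr0, add0r) trmx1 mul1mx mulmx1.
  by congr block_mx; apply/matrixP => i j; rewrite !mxE !ord1 mulr1n.
by rewrite HBH BQ trmx_mul HT !mulmxA.
Qed.

(** * Positive definite matrices, square roots and Sylvester equations *)

Section SpdAlgebra.
Context {R : realType}.

Definition sqnorm m n (A : 'M[R]_(m, n)) : R := \tr (A *m A^T).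

Lemma sqnormE m n (A : 'M[R]_(m, n)) : sqnorm A = \sum_i \sum_j A i j ^+ 2.
Proof.
apply: eq_bigr => i _; rewrite mxE; apply: eq_bigr => j _.
by rewrite mxE expr2.
Qed.

Lemma sqnorm_ge0 m n (A : 'M[R]_(m, n)) : 0 <= sqnorm A.
Proof. by rewrite sqnormE; do 2!apply: sumr_ge0 => ? _; exact: sqr_ge0. Qed.

Lemma sqr_le_sqnorm m n (A : 'M[R]_(m, n)) i j : A i j ^+ 2 <= sqnorm A.
Proof.
rewrite sqnormE (bigD1 i) //= (bigD1 j) //= -addrA lerDl addr_ge0 //.
  by apply: sumr_ge0 => k _; exact: sqr_ge0.
by do 2!apply: sumr_ge0 => ? _; exact: sqr_ge0.
Qed.

Lemma sqnorm_eq0 m n (A : 'M[R]_(m, n)) : sqnorm A <= 0 -> A = 0.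
Proof.
move=> A0; apply/matrixP => i j; rewrite mxE; apply/eqP.
by rewrite -sqrf_eq0 eq_le sqr_ge0 (le_trans (sqr_le_sqnorm A i j)).
Qed.

Lemma sqnorm0 m n : sqnorm (0 : 'M[R]_(m, n)) = 0.
Proof. by rewrite /sqnorm mul0mx mxtrace0. Qed.

Context {n : nat}.
Implicit Types (P Q A B H W : 'M[R]_n) (d : 'rV[R]_n).

(** Quadratic forms are written as traces, for a whole matrix [H] of test vectors at
   once, because the estimates below test against matrices. *)
Lemma quadratic_formE m (H : 'M[R]_(m, n)) Q d :
  \tr (H *m (Q^T *m diag_mx d *m Q) *m H^T) =
  \sum_i \sum_j d 0 j * (H *m Q^T) i j ^+ 2.
Proof.
rewrite !mulmxA -[_ *m Q *m _]mulmxA -{2}[Q]trmxK -trmx_mul.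
apply: eq_bigr => i _; rewrite mxE; apply: eq_bigr => j _.
by rewrite mul_mx_diag !mxE mulrAC mulrC expr2.
Qed.

Lemma spd_spectrum_gt0 Q d i :
  Q *m Q^T = 1%:M -> spd (Q^T *m diag_mx d *m Q) -> 0 < d 0 i.
Proof.
move=> QQ [_ pos]; pose x := Q^T *m (delta_mx i 0 : 'cV_n).
have Qx : Q *m x = delta_mx i 0 by rewrite mulmxA QQ mul1mx.
have xn0 : x != 0.
  apply/eqP => x0; move: Qx; rewrite x0 mulmx0 => /matrixP/(_ i 0)/eqP.
  by rewrite !mxE !eqxx eq_sym oner_eq0.
have := pos x xn0; rewrite !mulmxA -[x^T *m Q^T]trmx_mul -mulmxA Qx -trace_mx11.
rewrite trmx_delta -rowE row_diag_mx -!scalemxAl -mulmxA Qx mul_delta_mx.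
by rewrite linearZ /= trace_mx11 mxE !eqxx mulr1.
Qed.

Lemma spd_spectral Q d :
  Q *m Q^T = 1%:M -> (forall i, 0 < d 0 i) -> spd (Q^T *m diag_mx d *m Q).
Proof.
move=> QQ dpos; split=> [|x xn0].
  by rewrite /sym !trmx_mul trmxK tr_diag_mx mulmxA.
have y0 : (x^T *m Q^T) != 0.
  apply/eqP => y0; move/eqP: xn0; apply.
  by rewrite -[x]mul1mx -(mulmx1C QQ) -mulmxA -[Q *m x]trmxK trmx_mul y0 trmx0 mulmx0.
rewrite -trace_mx11 -{2}[x]trmxK quadratic_formE.
have [i0 [j yij]] := matrix0Pn _ y0.
rewrite ord1 in yij.
rewrite big_ord1 (bigD1 j) //= ltr_wpDr //.
  by apply: sumr_ge0 => k _; rewrite mulr_ge0 ?sqr_ge0 // ltW.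
by rewrite mulr_gt0 // exprn_even_gt0.
Qed.

(** The smallest eigenvalue is a lower bound of the quadratic form. The minimum is
   capped at 1 so that it is positive in dimension zero as well. *)
Lemma spd_coercive P : spd P ->
  exists2 c : R, 0 < c &
    forall m (H : 'M[R]_(m, n)), c * sqnorm H <= \tr (H *m P *m H^T).
Proof.
move=> hP; have [Q [d QQ PE]] := real_spectral (proj1 hP).
have dpos i : 0 < d 0 i by apply: (spd_spectrum_gt0 i QQ); rewrite -PE.
exists (\big[Num.min/1]_i d 0 i).
  by apply/bigmin_gtP; split => // i _.
move=> m H; rewrite PE quadratic_formE.
have -> : sqnorm H = sqnorm (H *m Q^T).
  by rewrite /sqnorm trmx_mul trmxK mulmxA -[_ *m _ *m Q]mulmxA (mulmx1C QQ) mulmx1.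
rewrite sqnormE mulr_sumr; apply: ler_sum => i _.
rewrite mulr_sumr; apply: ler_sum => j _.
by rewrite ler_wpM2r ?sqr_ge0 // bigmin_le_cond.
Qed.

(** Pair the value [Q *m H + H *m P] with [H]: the term of [Q] is nonnegative and that
   of [P] is coercive. The constant depends on [P] alone, so the bound is uniform
   in [Q]; with the square roots of two matrices as [Q] and [P], their difference
   as [H] gives the difference of the two matrices. Injectivity and Lipschitz
   continuity of the square root both come from this. *)
Lemma sylvester_bound P : spd P ->
  exists2 c : R, 0 < c &
    forall Q H, spd Q -> c * sqnorm H <= sqnorm (Q *m H + H *m P).
Proof.
move=> hP; have [c c0 hc] := spd_coercive hP.
exists (c ^+ 2); first by rewrite exprn_gt0.
move=> Q H hQ; set Y := Q *m H + H *m P.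
have YH : c * sqnorm H <= \tr (Y *m H^T).
  rewrite /Y mulmxDl mxtraceD (le_trans (hc _ H)) // lerDr.
  rewrite mxtrace_mulC mulmxA -{2}[H]trmxK.
  have [e e0 he] := spd_coercive hQ.
  by rewrite (le_trans _ (he _ _)) // mulr_ge0 ?sqnorm_ge0 // ltW.
have HY : \tr (H *m Y^T) = \tr (Y *m H^T).
  by rewrite -[LHS]mxtrace_tr trmx_mul trmxK.
(* Expanding this square replaces the Cauchy-Schwarz inequality. *)
have : sqnorm (Y - c *: H) =
    sqnorm Y - 2 * (c * \tr (Y *m H^T)) + c ^+ 2 * sqnorm H.
  have DT : (Y - c *: H)^T = Y^T - c *: H^T by rewrite raddfB /= linearZ.
  rewrite /sqnorm DT mulmxBl !mulmxBr -!scalemxAl -!scalemxAr.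
  by rewrite !raddfB /= !mxtraceZ HY; ring.
have := sqnorm_ge0 (Y - c *: H).
by move=> /[swap] -> h; have := ler_wpM2l (ltW c0) YH; nra.
Qed.

Lemma sylvester_unique Q P H : spd Q -> spd P -> Q *m H + H *m P = 0 -> H = 0.
Proof.
move=> hQ hP QHP; have [c c0 hc] := sylvester_bound hP.
by apply: sqnorm_eq0; rewrite -(pmulr_rle0 _ c0) (le_trans (hc _ _ hQ)) // QHP sqnorm0.
Qed.

Lemma sqrtmxP P : spd P -> spd (sqrtmx P) /\ sqrtmx P *m sqrtmx P = P.
Proof.
move=> hP; rewrite /sqrtmx; apply: (@xgetPex _ 0 [set B | spd B /\ B *m B = P]%classic).
have [Q [d QQ PE]] := real_spectral (proj1 hP).
have dpos i : 0 < d 0 i by apply: (spd_spectrum_gt0 i QQ); rewrite -PE.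
exists (Q^T *m diag_mx (\row_i Num.sqrt (d 0 i)) *m Q); split.
  by apply: spd_spectral => // i; rewrite mxE sqrtr_gt0.
rewrite PE !mulmxA -[_ *m Q *m Q^T]mulmxA QQ mulmx1 -[_ *m diag_mx _ *m diag_mx _]mulmxA.
rewrite mulmx_diag; congr (_ *m diag_mx _ *m _); apply/rowP => i.
by rewrite !mxE -expr2 sqr_sqrtr // ltW.
Qed.

Lemma sqrtmx_unique P B : spd B -> B *m B = P -> spd P -> sqrtmx P = B.
Proof.
move=> hB BB hP; have [hS SS] := sqrtmxP hP.
apply/eqP; rewrite -subr_eq0; apply/eqP/(sylvester_unique hS hB).
by rewrite mulmxBr mulmxBl SS BB addrA subrK subrr.
Qed.

Lemma spd_unit P : spd P -> P \in unitmx.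
Proof.
move=> hP; have [c c0 hc] := spd_coercive hP.
rewrite -row_free_unit; apply/inj_row_free => v vP.
by apply: sqnorm_eq0; rewrite -(pmulr_rle0 _ c0) (le_trans (hc _ _)) // vP mul0mx mxtrace0.
Qed.

Lemma spd_congr P A : spd P -> A \in unitmx -> spd (A^T *m P *m A).
Proof.
move=> [symP posP] uA; split; first by rewrite /sym !trmx_mul trmxK symP mulmxA.
move=> x xn0; rewrite !mulmxA -[x^T *m _]trmx_mul -mulmxA; apply: posP.
by apply/eqP => Ax; move/eqP: xn0; apply; rewrite -[x](mulKmx uA) Ax mulmx0.
Qed.

Lemma sym_inv A : sym A -> sym (invmx A).
Proof. by rewrite /sym trmx_inv => ->. Qed.

Lemma spd_inv P : spd P -> spd (invmx P).
Proof.
move=> hP; have uP := spd_unit hP; have := spd_congr hP (_ : invmx P \in unitmx).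
by rewrite unitmx_inv => /(_ uP); rewrite (sym_inv (proj1 hP)) mulVmx // mul1mx.
Qed.

Lemma sym_congr A B : sym A -> sym B -> sym (A *m B *m A).
Proof. by rewrite /sym !trmx_mul => -> ->; rewrite mulmxA. Qed.

Lemma spd_sandwich P B : spd P -> spd B -> spd (B *m P *m B).
Proof. by move=> hP hB; rewrite -{1}(proj1 hB); exact/spd_congr/spd_unit. Qed.

End SpdAlgebra.

(** * Differentiation of matrix-valued curves *)

Section MatrixCalculus.
Context {R : realType}.

Lemma is_derive_mxP m n (M : R -> 'M[R]_(m, n)) (t : R) D :
  is_derive t 1 M D <-> forall i j, is_derive t (1 : R) (fun x => M x i j) (D i j).
Proof.
split=> [[dM <-] i j|dM].
  split; first exact: (derivable_mxP _ _ _).1.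
  by rewrite derive_mx // mxE.
have dM' : derivable M t 1 by apply/derivable_mxP => i j; have [] := dM i j.
split=> //; rewrite derive_mx //; apply/matrixP => i j; rewrite mxE.
by have [_ <-] := dM i j.
Qed.

Lemma is_derive_sumf n (h : 'I_n -> R -> R) (t : R) (dh : 'I_n -> R) :
  (forall i, is_derive t (1 : R) (h i) (dh i)) ->
  is_derive t (1 : R) (fun x => \sum_i h i x) (\sum_i dh i).
Proof.
move=> dhP; have := is_derive_sum dhP.
by rewrite (_ : \sum_i h i = fun x => \sum_i h i x) //; apply/funext => x; rewrite fct_sumE.
Qed.

Lemma is_derive_mulmx m n p (M : R -> 'M[R]_(m, n)) (N : R -> 'M[R]_(n, p))
    (t : R) DM DN :
  is_derive t 1 M DM -> is_derive t 1 N DN ->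
  is_derive t 1 (fun x => M x *m N x) (DM *m N t + M t *m DN).
Proof.
move=> /is_derive_mxP dM /is_derive_mxP dN; apply/is_derive_mxP => i j.
rewrite (_ : (fun x => (M x *m N x) i j) = fun x => \sum_k M x i k * N x k j); last first.
  by apply/funext => x; rewrite mxE.
rewrite !mxE -big_split /=; apply: is_derive_sumf => k.
apply: (is_derive_eq (is_deriveM (dM i k) (dN k j))).
by rewrite addrC [N t k j *: _]mulrC.
Qed.

Lemma is_derive_mulmxl m n p (A : 'M[R]_(m, n)) (N : R -> 'M[R]_(n, p)) (t : R) DN :
  is_derive t 1 N DN -> is_derive t 1 (fun x => A *m N x) (A *m DN).
Proof.
move=> dN; apply: is_derive_eq.
  exact: (is_derive_mulmx (is_derive_cst A t 1) dN).
by rewrite mul0mx add0r.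
Qed.

Lemma is_derive_mulmxr m n p (A : 'M[R]_(n, p)) (N : R -> 'M[R]_(m, n)) (t : R) DN :
  is_derive t 1 N DN -> is_derive t 1 (fun x => N x *m A) (DN *m A).
Proof.
move=> dN; apply: is_derive_eq.
  exact: (is_derive_mulmx dN (is_derive_cst A t 1)).
by rewrite mulmx0 addr0.
Qed.

Lemma is_derive_mxtrace n (M : R -> 'M[R]_n) (t : R) D :
  is_derive t 1 M D -> is_derive t (1 : R) (fun x => \tr (M x)) (\tr D).
Proof. by move=> /is_derive_mxP dM; apply: is_derive_sumf => i. Qed.

Lemma derivable_prod (I : Type) (r : seq I) (P : pred I) (f : I -> R -> R) (t : R) :
  (forall i, derivable (f i) t 1) ->
  derivable (fun x => \prod_(i <- r | P i) f i x) t 1.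
Proof.
move=> df; elim: r => [|i r IHr].
  by rewrite (_ : (fun _ => _) = cst 1) //; apply/funext => x; rewrite big_nil.
rewrite (_ : (fun _ => _) = if P i then (fun x => f i x * \prod_(i <- r | P i) f i x)
   else (fun x => \prod_(i <- r | P i) f i x)); last first.
  by apply/funext => x; rewrite big_cons; case: ifP.
case: ifP => _; last exact: IHr.
by apply: derivableM; [exact: df|exact: IHr].
Qed.

Lemma derivable_bigsum (I : Type) (r : seq I) (P : pred I) (f : I -> R -> R) (t : R) :
  (forall i, derivable (f i) t 1) ->
  derivable (fun x => \sum_(i <- r | P i) f i x) t 1.
Proof.
move=> df; elim: r => [|i r IHr].
  by rewrite (_ : (fun _ => _) = cst 0) //; apply/funext => x; rewrite big_nil.
rewrite (_ : (fun _ => _) = if P i then (fun x => f i x + \sum_(i <- r | P i) f i x)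
   else (fun x => \sum_(i <- r | P i) f i x)); last first.
  by apply/funext => x; rewrite big_cons; case: ifP.
case: ifP => _; last exact: IHr.
by apply: derivableD; [exact: df|exact: IHr].
Qed.

Lemma derivable_det n (M : R -> 'M[R]_n) (t : R) :
  derivable M t 1 -> derivable (fun x => \det (M x)) t 1.
Proof.
move=> /derivable_mxP dM; apply: derivable_bigsum => s; apply: derivableM.
  exact: derivable_cst.
by apply: derivable_prod => i.
Qed.

(** Cramer's rule, valid near [t] because the determinant is continuous, shows that
   the inverse is differentiable; differentiating the product of the matrix with
   its inverse then gives the value of the derivative. *)
Lemma is_derive_invmx n (M : R -> 'M[R]_n) (t : R) D :
  M t \in unitmx -> is_derive t 1 M D ->
  is_derive t 1 (fun x => invmx (M x)) (- (invmx (M t) *m D *m invmx (M t))).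
Proof.
move=> uM dM; have [derM _] := dM.
have ddet := derivable_det derM.
have nearu : \forall x \near t, M x \in unitmx.
  have cdet : {for t, continuous (fun x => \det (M x))}.
    by apply: differentiable_continuous; apply/derivable1_diffP.
  have det0 : \det (M t) != 0 by rewrite -unitfE -unitmxE.
  near=> x; rewrite unitmxE unitfE; near: x.
  exact: (cvgr_neq0 (\det (M t))).
have dinv : derivable (fun x => invmx (M x)) t 1.
  apply: (@near_eq_derivable _ _ _ (fun x => (\det (M x))^-1 *: \adj (M x))).
    by near=> x; rewrite /invmx ifT //; near: x.
  apply/derivable_mxP => i j.
  rewrite (_ : (fun _ => _) = (fun x => (\det (M x))^-1 * (cofactor (M x) j i))); last first.
    by apply/funext => x; rewrite !mxE.
  apply: derivableM.
    by apply: derivableV => //; rewrite -unitfE -unitmxE.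
  apply: derivableM; first exact: derivable_cst.
  apply: derivable_det; apply/derivable_mxP => k l.
  rewrite (_ : (fun _ => _) = (fun x => M x (lift j k) (lift i l))).
    exact: (derivable_mxP _ _ _).1.
  by apply/funext => x; rewrite !mxE.
have [E dE] : exists E, is_derive t 1 (fun x => invmx (M x)) E.
  by exists ('D_1 (fun x => invmx (M x)) t); exact: DeriveDef.
have d1 := is_derive_mulmx dM dE.
have : is_derive t 1 (fun x => M x *m invmx (M x)) 0.
  apply: near_eq_is_derive (is_derive_cst 1%:M t 1).
  by near=> x; rewrite mulmxV //; near: x.
move=> [_ d0]; have [_ d1E] := d1; rewrite d0 in d1E.
suff -> : - (invmx (M t) *m D *m invmx (M t)) = E by [].
move/eqP: d1E; rewrite eq_sym addrC addr_eq0 => /eqP ME.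
by rewrite -mulmxA -mulmxN -ME mulKmx.
Unshelve. all: by end_near. Qed.

Lemma is_derive_line n (f : 'M[R]_n -> R) (P A : 'M[R]_n) (d : R) :
  is_derive (0 : R) (1 : R) (fun h => f (h *: A + P)) d -> is_derive P A f d.
Proof.
move=> [d1 <-]; split; first exact/derivable1P.
rewrite /derive; apply: (congr1 (fun g : R -> R => lim (g @ 0^')%classic)).
apply/funext => h /=.
by rewrite addr0 scale0r add0r [_%:A]mulr1.
Qed.

Lemma derive0_constant m n (M : R -> 'M[R]_(m, n)) :
  (forall t : R, is_derive t 1 M 0) -> forall t, M t = M 0.
Proof.
move=> dM t; apply/matrixP => i j.
apply: (@is_derive_0_is_cst _ (fun x => M x i j)) => x.
by have /is_derive_mxP/(_ i j) := dM x; rewrite mxE.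
Qed.

Lemma is_derive1P m n (M : R -> 'M[R]_(m, n)) (t : R) :
  derivable M t 1 -> is_derive t 1 M (derive1 M t).
Proof. by move=> dM; rewrite derive1E; exact: DeriveDef. Qed.

Lemma derive1_eq m n (M : R -> 'M[R]_(m, n)) (t : R) D :
  is_derive t 1 M D -> derive1 M t = D.
Proof. by move=> [_ <-]; rewrite derive1E. Qed.

End MatrixCalculus.

(** * Exponential flows of symmetric matrices *)

Section ExponentialFlow.
Context {R : realType} {n : nat}.
Implicit Types (P Q A B H W L N : 'M[R]_n) (d : 'rV[R]_n) (t k : R).

Definition eigensystem W : 'M[R]_n * 'rV[R]_n :=
  xget (1%:M, 0) [set Qd | Qd.1 *m Qd.1^T = 1%:M /\
                           W = Qd.1^T *m diag_mx Qd.2 *m Qd.1]%classic.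

Definition expdiag Q d t : 'M[R]_n :=
  Q^T *m diag_mx (\row_i expR (t * d 0 i)) *m Q.

(** The one-parameter group generated by a symmetric matrix [W], through a chosen
   eigensystem instead of a power series. It is locked because the matching of
   products by associativity would otherwise unfold it. *)
Definition expflow : 'M[R]_n -> R -> 'M[R]_n :=
  locked (fun W t => expdiag (eigensystem W).1 (eigensystem W).2 t).

Lemma eigensystemP W (Q := (eigensystem W).1) (d := (eigensystem W).2) :
  sym W -> Q *m Q^T = 1%:M /\ W = Q^T *m diag_mx d *m Q.
Proof.
move=> /real_spectral[Q0 [d0 QQ WE]]; rewrite /Q /d /eigensystem.
case: xgetP => [_ -> //|/(_ (Q0, d0))[]]; by split.
Qed.

Lemma expdiagD Q d s t : Q *m Q^T = 1%:M ->
  expdiag Q d (s + t) = expdiag Q d s *m expdiag Q d t.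
Proof.
move=> QQ; rewrite /expdiag !mulmxA -[_ *m Q *m Q^T]mulmxA QQ mulmx1.
rewrite -[_ *m diag_mx _ *m diag_mx _]mulmxA mulmx_diag.
by congr (_ *m diag_mx _ *m _); apply/rowP => i; rewrite !mxE mulrDl expRD.
Qed.

Lemma expdiag0 Q d : Q *m Q^T = 1%:M -> expdiag Q d 0 = 1%:M.
Proof.
move=> QQ; rewrite /expdiag (_ : diag_mx _ = 1%:M) ?mulmx1 ?(mulmx1C QQ) //.
by apply/matrixP => i j; rewrite !mxE mul0r expR0.
Qed.

Lemma expdiag_spd Q d t : Q *m Q^T = 1%:M -> spd (expdiag Q d t).
Proof. by move=> QQ; apply: spd_spectral => // i; rewrite mxE expR_gt0. Qed.

Lemma expdiag_comm Q d t (W := Q^T *m diag_mx d *m Q) : Q *m Q^T = 1%:M ->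
  W *m expdiag Q d t = expdiag Q d t *m W.
Proof.
move=> QQ; rewrite /W /expdiag !mulmxA -![_ *m Q *m Q^T]mulmxA QQ !mulmx1.
rewrite -![_ *m diag_mx _ *m diag_mx _]mulmxA !mulmx_diag.
by congr (_ *m diag_mx _ *m _); apply/rowP => i; rewrite !mxE mulrC.
Qed.

Lemma is_derive_expdiag Q d k t (W := Q^T *m diag_mx d *m Q) : Q *m Q^T = 1%:M ->
  is_derive t 1 (fun x => expdiag Q d (k * x)) (k *: (W *m expdiag Q d (k * t))).
Proof.
move=> QQ; rewrite /expdiag.
have dD : is_derive t 1 (fun x => diag_mx (\row_i expR (k * x * d 0 i)))
    (k *: (diag_mx d *m diag_mx (\row_i expR (k * t * d 0 i)))).
  apply/is_derive_mxP => i j; rewrite mulmx_diag !mxE.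
  rewrite mulrb (_ : (fun _ => _) =
      fun x => if i == j then expR (k * d 0 i * x) else 0); last first.
    by apply/funext => x; rewrite !mxE mulrb mulrAC.
  case: ifP => _; last by rewrite mulr0; exact: is_derive_cst.
  have dl : is_derive t (1 : R) (fun x => k * d 0 i * x) (k * d 0 i).
    have := is_deriveZ (k * d 0 i) (is_derive_id t (1 : R)).
    by rewrite [_ *: 1]mulr1.
  have := is_derive1_comp (is_derive_expR (k * d 0 i * t)) dl.
  by move=> h; apply: (is_derive_eq h); rewrite mulrAC mulrC mulrA.
have := is_derive_mulmxr Q (is_derive_mulmxl Q^T dD).
move=> h; apply: (is_derive_eq h).
rewrite -scalemxAr -scalemxAl; congr (_ *: _).
rewrite /W !mulmxA -[_ *m Q *m Q^T]mulmxA QQ mulmx1.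
by [].
Qed.

Lemma expflowE W t :
  expflow W t = expdiag (eigensystem W).1 (eigensystem W).2 t.
Proof. by rewrite /expflow -lock. Qed.

Lemma expflowD W s t : sym W -> expflow W (s + t) = expflow W s *m expflow W t.
Proof. by move=> /eigensystemP[QQ _]; rewrite !expflowE; exact: expdiagD. Qed.

Lemma expflow0 W : sym W -> expflow W 0 = 1%:M.
Proof. by move=> /eigensystemP[QQ _]; rewrite !expflowE; exact: expdiag0. Qed.

Lemma expflow_spd W t : sym W -> spd (expflow W t).
Proof. by move=> /eigensystemP[QQ _]; rewrite !expflowE; exact: expdiag_spd. Qed.

Lemma expflow_comm W t : sym W -> W *m expflow W t = expflow W t *m W.
Proof.
move=> /eigensystemP[QQ WE].
by have := expdiag_comm (eigensystem W).2 t QQ; rewrite expflowE -WE.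
Qed.

Lemma is_derive_expflow W k t : sym W ->
  is_derive t 1 (fun x => expflow W (k * x)) (k *: (W *m expflow W (k * t))).
Proof.
move=> /eigensystemP[QQ WE]; rewrite (_ : (fun _ => _) =
    fun x => expdiag (eigensystem W).1 (eigensystem W).2 (k * x)).
  by rewrite expflowE; have := is_derive_expdiag (eigensystem W).2 k t QQ; rewrite -WE.
by apply/funext => x; rewrite expflowE.
Qed.

Lemma expflowNK W t : sym W -> expflow W (- t) *m expflow W t = 1%:M.
Proof. by move=> hW; rewrite -expflowD // addNr expflow0. Qed.

Lemma expflowKN W t : sym W -> expflow W t *m expflow W (- t) = 1%:M.
Proof. by move=> hW; rewrite -expflowD // subrr expflow0. Qed.

(** Multiplying a solution by the two flows run backwards gives a constant curve. *)
Lemma linear_flow_unique L N (M : R -> 'M[R]_n) : sym L -> sym N ->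
  (forall t, is_derive t 1 M (L *m M t + M t *m N)) ->
  forall t, M t = expflow L t *m M 0 *m expflow N t.
Proof.
move=> hL hN dM t.
pose G (x : R) := expflow L (-1 * x) *m M x *m expflow N (-1 * x).
have dG (x : R) : is_derive x 1 G 0.
  have h := is_derive_mulmx (is_derive_mulmx (is_derive_expflow (-1) x hL) (dM x))
     (is_derive_expflow (-1) x hN).
  apply: (is_derive_eq h); rewrite !scaleN1r !mulNmx mulmxN.
  by rewrite (expflow_comm _ hL) mulmxDr !mulmxA addKr subrr.
have := derive0_constant dG t.
rewrite /G mulr0 !expflow0 // mul1mx mulmx1 => <-.
rewrite !mulN1r !mulmxA expflowKN // mul1mx -mulmxA expflowNK //.
by rewrite mulmx1.
Qed.

Lemma expflow_0mx t : expflow 0 t = 1%:M.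
Proof.
have h0 : sym (0 : 'M[R]_n) by rewrite /sym trmx0.
have d0 (y : R) : is_derive y 1 (expflow 0) 0.
  have h := is_derive_expflow 1 y h0.
  rewrite (_ : expflow 0 = fun x => expflow 0 (1 * x)).
    by apply: (is_derive_eq h); rewrite mul0mx scaler0.
  by apply/funext => z; rewrite mul1r.
by rewrite (derive0_constant d0) expflow0.
Qed.

(** Both sides solve the same linear equation. This makes the flow independent of the
   eigensystem, which rescaling and logarithms need. *)
Lemma expdiag_expflow Q d t : Q *m Q^T = 1%:M ->
  expdiag Q d t = expflow (Q^T *m diag_mx d *m Q) t.
Proof.
move=> QQ; set W := Q^T *m _ *m Q.
have hW : sym W by rewrite /sym !trmx_mul trmxK tr_diag_mx mulmxA.
have h0 : sym (0 : 'M[R]_n) by rewrite /sym trmx0.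
have dE (x : R) : is_derive x 1 (expdiag Q d) (W *m expdiag Q d x + expdiag Q d x *m 0).
  have h := is_derive_expdiag d 1 x QQ.
  rewrite (_ : expdiag Q d = fun x => expdiag Q d (1 * x)).
    by apply: (is_derive_eq h); rewrite mul1r scale1r mulmx0 addr0.
  by apply/funext => z; rewrite mul1r.
by rewrite (linear_flow_unique hW h0 dE) expdiag0 // mulmx1 expflow_0mx mulmx1.
Qed.

Lemma expflowZ W k t : sym W -> expflow (k *: W) t = expflow W (k * t).
Proof.
move=> /eigensystemP[QQ WE].
have -> : k *: W = (eigensystem W).1^T *m diag_mx (k *: (eigensystem W).2)
    *m (eigensystem W).1.
  by rewrite {1}WE linearZ /= -scalemxAr -scalemxAl.
rewrite -expdiag_expflow // expflowE /expdiag.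
by congr (_ *m diag_mx _ *m _); apply/rowP => i; rewrite !mxE mulrCA mulrA.
Qed.

Lemma exists_log P : spd P -> exists2 W, sym W & expflow W 1 = P.
Proof.
move=> hP; have [Q [d QQ PE]] := real_spectral (proj1 hP).
exists (Q^T *m diag_mx (\row_i ln (d 0 i)) *m Q).
  by rewrite /sym !trmx_mul trmxK tr_diag_mx mulmxA.
rewrite -expdiag_expflow // PE /expdiag.
congr (_ *m diag_mx _ *m _); apply/rowP => i; rewrite !mxE mul1r lnK //.
by rewrite posrE; apply: (spd_spectrum_gt0 i QQ); rewrite -PE.
Qed.

End ExponentialFlow.

(** * The Levi-Civita connection of the affine-invariant metric *)

Section LeviCivita.
Context {R : realType} {n : nat}.
Implicit Types (P Q A B C D : 'M[R]_n).

(** The Christoffel symbol of the affine-invariant metric. *)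
Definition affine_gamma P A B : 'M[R]_n :=
  - 2^-1 *: (A *m invmx P *m B + B *m invmx P *m A).

Lemma affine_gamma_diag P A : affine_gamma P A A = - (A *m invmx P *m A).
Proof.
rewrite /affine_gamma scaleNr scalerDr -scalerDl (_ : 2^-1 + _ = 1); last by field.
by rewrite scale1r.
Qed.

Lemma fisher_raoC P A B : fisher_rao P A B = fisher_rao P B A.
Proof. by rewrite /fisher_rao -mulmxA mxtrace_mulC mulmxA. Qed.

(** With [S] the square root of the inverse of [P], the inner product of [D] with
   itself is the Frobenius norm of [S *m D *m S], hence the metric is definite. *)
Lemma fisher_rao_eq0 P D : spd P -> sym D -> fisher_rao P D D = 0 -> D = 0.
Proof.
move=> hP hD; have [hS SS] := sqrtmxP (spd_inv hP).
set S := sqrtmx (invmx P) in hS SS.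
have uS := spd_unit hS.
have -> : fisher_rao P D D = sqnorm (S *m D *m S).
  rewrite /fisher_rao /sqnorm !trmx_mul hD (proj1 hS) -SS.
  by rewrite mxtrace_mulC !mulmxA mxtrace_mulC !mulmxA.
move=> F0; have SDS : S *m D *m S = 0 by apply: sqnorm_eq0; rewrite F0.
by rewrite -[D](mulKmx uS) -[S *m D](mulmxK uS) SDS mul0mx mulmx0.
Qed.

Lemma is_derive_fisher_rao P A B C : spd P ->
  is_derive P A (fun Q => fisher_rao Q B C)
    (- \tr (invmx P *m A *m invmx P *m B *m invmx P *m C)
     - \tr (invmx P *m B *m invmx P *m A *m invmx P *m C)).
Proof.
move=> hP; apply: is_derive_line; rewrite /fisher_rao.
have dl : is_derive (0 : R) 1 (fun h : R => h *: A + P) A.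
  apply/is_derive_mxP => i j.
  rewrite (_ : (fun _ => _) = (fun h => A i j * h) \+ cst (P i j)); last first.
    by apply/funext => h; rewrite !mxE mulrC.
  have := is_deriveD (is_deriveZ (A i j) (is_derive_id (0 : R) (1 : R)))
    (is_derive_cst (P i j) (0 : R) (1 : R)).
  by rewrite addr0 [_ *: 1]mulr1.
have P0 : 0 *: A + P = P by rewrite scale0r add0r.
have uP : 0 *: A + P \in unitmx by rewrite P0; exact: spd_unit.
have dI := is_derive_invmx uP dl.
have h := is_derive_mxtrace (is_derive_mulmxr C (is_derive_mulmx (is_derive_mulmxr B dI) dI)).
apply: (is_derive_eq h); rewrite P0.
by rewrite !mulmxN !mulNmx mulmxDl !mulNmx mxtraceD !raddfN /= !mulmxA.
Qed.

Lemma affine_gammaP : levi_civita affine_gamma.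
Proof.
move=> P hP; have symI := sym_inv (proj1 hP); split.
- move=> A B hA hB; rewrite /sym /affine_gamma linearZ /= linearD /= !trmx_mul.
  by rewrite hA hB symI !mulmxA addrC.
- move=> k A B C _ _ _; rewrite /affine_gamma.
  rewrite !(mulmxDl, mulmxDr) -!scalemxAl -!scalemxAr.
  rewrite scalerA mulrC -scalerA -scalerDr; congr (_ *: _).
  by rewrite scalerDr addrACA.
- by move=> A B _ _; rewrite /affine_gamma addrC.
- move=> A B C _ _ _; apply: (is_derive_eq (is_derive_fisher_rao A B C hP)).
  rewrite /fisher_rao /affine_gamma.
  rewrite -!(scalemxAr, scalemxAl) !mxtraceZ !(mulmxDr, mulmxDl) !mxtraceD !mulmxA.
  set a := \tr (_ *m A *m _ *m B *m _ *m C).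
  set b := \tr (_ *m B *m _ *m A *m _ *m C).
  have -> : \tr (invmx P *m B *m invmx P *m C *m invmx P *m A) = a.
    by rewrite -mulmxA mxtrace_mulC /a !mulmxA.
  by field.
Qed.

(** The Koszul argument: the difference [D] of two such connections is symmetric in
   its two arguments and skew under exchange of the second one with the vector it
   is paired with. Six alternate exchanges turn the pairing of [D A B] with any
   symmetric matrix into its opposite; the matrix chosen is [D A B] itself. *)
Lemma levi_civita_unique G G' P A B : levi_civita G -> levi_civita G' ->
  spd P -> sym A -> sym B -> G P A B = G' P A B.
Proof.
move=> hG hG' hP hA hB.
have [symG _ torG metG] := hG P hP.
have [symG' _ torG' metG'] := hG' P hP.
pose D X Y := G P X Y - G' P X Y.
pose g X Y := fisher_rao P X Y.
have gB X Y Z : g (X - Y) Z = g X Z - g Y Z.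
  by rewrite /g /fisher_rao mulmxBr !mulmxBl raddfB.
have symD X Y : sym X -> sym Y -> sym (D X Y).
  by move=> hX hY; rewrite /sym /D linearB /= symG // symG'.
have torD X Y : sym X -> sym Y -> D X Y = D Y X.
  by move=> hX hY; rewrite /D torG // torG'.
have skew X Y Z : sym X -> sym Y -> sym Z -> g (D X Y) Z = - g (D X Z) Y.
  move=> hX hY hZ; have [_ e] := metG X Y Z hX hY hZ.
  have [_] := metG' X Y Z hX hY hZ; rewrite e => {}e.
  apply/eqP; rewrite -subr_eq0 opprK /D !gB addrACA -opprD.
  by move: e; rewrite !(fisher_raoC P Y) /g => ->; rewrite subrr.
apply/eqP; rewrite -subr_eq0; apply/eqP; apply: (fisher_rao_eq0 hP).
  exact: symD.
set Z := G P A B - G' P A B; have hZ : sym Z by exact: symD.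
have := skew A B Z hA hB hZ; have := skew Z A B hZ hA hB.
have := skew B Z A hB hZ hA.
rewrite (torD A Z) // (torD Z B) // (torD B A) // => -> -> e.
by rewrite -/(g (D A B) Z); lra.
Qed.

Lemma christoffelE P A B : spd P -> sym A -> sym B ->
  christoffel P A B = affine_gamma P A B.
Proof.
move=> hP hA hB; apply: levi_civita_unique => //; last exact: affine_gammaP.
by apply: (@xgetPex _ _ levi_civita); exists affine_gamma; exact: affine_gammaP.
Qed.

End LeviCivita.

(** * Geodesics and parallel fields *)

Section Geodesics.
Context {R : realType} {n : nat}.
Implicit Types (P Q A B s W V z p v : 'M[R]_n) (t : R).

Definition geo s W t : 'M[R]_n := s *m expflow W t *m s.

(** The parallel field along [geo s W] with value [s *m z *m s] at time 0; for
   [z = W] it is the velocity of [geo s W]. *)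
Definition geo_field s W z t : 'M[R]_n :=
  s *m (expflow W (2^-1 * t) *m z *m expflow W (2^-1 * t)) *m s.

Lemma geo_spd s W t : spd s -> sym W -> spd (geo s W t).
Proof. by move=> hs hW; apply: spd_sandwich => //; exact: expflow_spd. Qed.

Lemma geo0 s W : sym W -> geo s W 0 = s *m s.
Proof. by move=> hW; rewrite /geo expflow0 // mulmx1. Qed.

Lemma expflow_half W t : sym W ->
  expflow W (2^-1 * t) *m expflow W (2^-1 * t) = expflow W t.
Proof. by move=> hW; rewrite -expflowD //; congr expflow; field. Qed.

Lemma is_derive_geo s W t : sym W ->
  is_derive t 1 (geo s W) (geo_field s W W t).
Proof.
move=> hW; have h := is_derive_mulmxr s (is_derive_mulmxl s (is_derive_expflow 1 t hW)).
rewrite (_ : geo s W = fun x => s *m expflow W (1 * x) *m s).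
  apply: (is_derive_eq h); rewrite scale1r mul1r -[in LHS](expflow_half _ hW).
  by rewrite /geo_field -(expflow_comm _ hW) !mulmxA.
by apply/funext => x; rewrite /geo mul1r.
Qed.

Lemma derive1_geo s W : sym W -> derive1 (geo s W) = geo_field s W W.
Proof. by move=> hW; apply/funext => t; exact/derive1_eq/is_derive_geo. Qed.

Lemma geo_field_sym s W z t : spd s -> sym W -> sym z -> sym (geo_field s W z t).
Proof.
move=> hs hW hz; apply: sym_congr; first exact: (proj1 hs).
by apply: sym_congr => //; exact: (proj1 (expflow_spd _ hW)).
Qed.

Lemma geo_field0 s W z : sym W -> geo_field s W z 0 = s *m z *m s.
Proof. by move=> hW; rewrite /geo_field mulr0 expflow0 // mul1mx mulmx1. Qed.

Lemma is_derive_geo_field s W z t : sym W ->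
  is_derive t 1 (geo_field s W z)
    (2^-1 *: (s *m (W *m (expflow W (2^-1 * t) *m z *m expflow W (2^-1 * t))
                  + (expflow W (2^-1 * t) *m z *m expflow W (2^-1 * t)) *m W) *m s)).
Proof.
move=> hW; have dE := is_derive_expflow 2^-1 t hW.
have h := is_derive_mulmxr s (is_derive_mulmxl s (is_derive_mulmx (is_derive_mulmxr z dE) dE)).
apply: (is_derive_eq h); rewrite -!scalemxAl -!scalemxAr -scalerDr -!scalemxAr -!scalemxAl.
by rewrite {2}(expflow_comm _ hW) !mulmxA.
Qed.

Lemma geo_inv s W t : spd s -> sym W ->
  invmx (geo s W t) = invmx s *m expflow W (- t) *m invmx s.
Proof.
move=> hs hW; have us := spd_unit hs; have uc := spd_unit (geo_spd t hs hW).
apply: (can_inj (mulmxK uc)); rewrite mulVmx // /geo.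
rewrite !mulmxA -[_ *m invmx s *m s]mulmxA mulVmx // mulmx1.
by rewrite -[_ *m expflow W _ *m expflow W _]mulmxA expflowNK // mulmx1 mulVmx.
Qed.

(** The logarithmic velocity is constant in time, which reduces the geodesic and
   parallel equations to linear equations with constant coefficients. *)
Lemma geo_velocityl s W t : spd s -> sym W ->
  geo_field s W W t *m invmx (geo s W t) = s *m W *m invmx s.
Proof.
move=> hs hW; have us := spd_unit hs.
rewrite geo_inv // /geo_field -(expflow_comm _ hW) -[W *m _ *m _]mulmxA expflow_half //.
rewrite !mulmxA -[_ *m s *m invmx s]mulmxA mulmxV // mulmx1.
by rewrite -[_ *m expflow W _ *m expflow W _]mulmxA expflowKN // mulmx1.
Qed.

Lemma geo_velocityr s W t : spd s -> sym W ->
  invmx (geo s W t) *m geo_field s W W t = invmx s *m W *m s.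
Proof.
move=> hs hW.
have := congr1 trmx (geo_velocityl t hs hW).
rewrite [LHS]trmx_mul trmx_inv (proj1 (geo_spd t hs hW)) (geo_field_sym t hs hW hW).
by move=> ->; rewrite !trmx_mul hW trmx_inv (proj1 hs) mulmxA.
Qed.

Lemma covderiv_geo s W (V : R -> 'M[R]_n) t : spd s -> sym W -> sym (V t) ->
  covderiv (geo s W) V t =
  derive1 V t - 2^-1 *: (s *m W *m invmx s *m V t + V t *m (invmx s *m W *m s)).
Proof.
move=> hs hW hV; rewrite /covderiv derive1_geo // christoffelE //.
- by rewrite /affine_gamma geo_velocityl // -[V t *m _ *m _]mulmxA geo_velocityr // scaleNr.
- exact: geo_spd.
- exact: geo_field_sym.
Qed.

Lemma parallel_geo_field s W z : spd s -> sym W -> sym z ->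
  parallel_along (geo s W) (geo_field s W z).
Proof.
move=> hs hW hz t; have hV := geo_field_sym t hs hW hz.
have dV := is_derive_geo_field s z t hW; have us := spd_unit hs.
split; [exact: hV|by case: dV|].
rewrite covderiv_geo // (derive1_eq dV) -scalerBr.
rewrite /geo_field; move: (_ *m z *m _) => E.
rewrite !mulmxA -[_ *m invmx s *m s]mulmxA mulVmx // mulmx1.
rewrite -[s *m E *m s *m invmx s]mulmxA mulmxV // mulmx1.
by rewrite mulmxDr mulmxDl !mulmxA subrr scaler0.
Qed.

(** The velocity is one of the parallel fields. *)
Lemma geodesic_geo s W : spd s -> sym W -> geodesic (geo s W).
Proof.
move=> hs hW; split=> [t|].
  by split; [exact: geo_spd|case: (is_derive_geo s t hW)].
by rewrite derive1_geo //; exact: parallel_geo_field.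
Qed.

(** After conjugation by [invmx s] a parallel field solves the equation
   [M' = (W *m M + M *m W) / 2]. *)
Lemma parallel_geoE s W (V : R -> 'M[R]_n) : spd s -> sym W ->
  parallel_along (geo s W) V ->
  V = geo_field s W (invmx s *m V 0 *m invmx s).
Proof.
move=> hs hW parV; have us := spd_unit hs; apply/funext => t.
pose M x := invmx s *m V x *m invmx s.
have h2 : sym (2^-1 *: W) by rewrite /sym linearZ /= hW.
have dM (x : R) : is_derive x 1 M ((2^-1 *: W) *m M x + M x *m (2^-1 *: W)).
  have [symV dV] := parV x; rewrite (covderiv_geo hs hW symV).
  move=> /eqP; rewrite subr_eq0 => /eqP V'E.
  have h := is_derive_mulmxr (invmx s) (is_derive_mulmxl (invmx s) (is_derive1P dV)).
  apply: (is_derive_eq h); rewrite V'E /M -!scalemxAr -!scalemxAl -scalerDr.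
  congr (_ *: _); rewrite mulmxDr mulmxDl !mulmxA mulVmx // mul1mx.
  by congr (_ + _); rewrite -[LHS]mulmxA mulmxV // mulmx1.
have := linear_flow_unique h2 h2 dM t; rewrite !expflowZ // => ME.
rewrite /geo_field -/(M 0) -ME /M !mulmxA mulmxV // mul1mx.
by rewrite -mulmxA mulVmx // mulmx1.
Qed.

(** The geodesic equation says that the matrix [invmx (c t) *m c' t] is constant, so
   that [c] itself solves a linear equation; after conjugation by the square root
   of the initial point its coefficient is the symmetric matrix [W]. *)
Lemma geodesicE (c : R -> 'M[R]_n) (s := sqrtmx (c 0))
    (W := invmx s *m derive1 c 0 *m invmx s) :
  geodesic c -> sym W /\ c = geo s W.
Proof.
move=> [hc parc]; have [hs ss] := sqrtmxP (hc 0).1.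
rewrite -/s in hs ss; have us := spd_unit hs.
have hW : sym W by apply: sym_congr; [exact/sym_inv/(proj1 hs)|case: (parc 0)].
split=> //; apply/funext => t.
have uc x : c x \in unitmx by exact: spd_unit (hc x).1.
have dc (x : R) : is_derive x 1 c (derive1 c x) by exact/is_derive1P/(hc x).2.
pose K x := invmx (c x) *m derive1 c x.
have dK (x : R) : is_derive x 1 K 0.
  have [symc' dc'] := parc x.
  rewrite /covderiv (christoffelE (hc x).1 symc' symc') affine_gamma_diag.
  move=> /eqP; rewrite subr_eq0 => /eqP c''E.
  have h := is_derive_mulmx (is_derive_invmx (uc x) (dc x)) (is_derive1P dc').
  by apply: (is_derive_eq h); rewrite c''E mulNmx !mulmxA addNr.
have c'E x : derive1 c x = c x *m K 0.
  by rewrite -(derive0_constant dK x) /K mulKVmx.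
have K0 : K 0 *m invmx s = invmx s *m W.
  rewrite /K /W !mulmxA; congr (_ *m _ *m _); apply: (can_inj (mulmxK (uc 0))).
  by rewrite mulVmx // -ss mulmxA mulmxKV // mulVmx.
pose M x := invmx s *m c x *m invmx s.
have h0 : sym (0 : 'M[R]_n) by rewrite /sym trmx0.
have dM (x : R) : is_derive x 1 M (0 *m M x + M x *m W).
  have h := is_derive_mulmxr (invmx s) (is_derive_mulmxl (invmx s) (dc x)).
  apply: (is_derive_eq h); rewrite mul0mx add0r /M c'E.
  by rewrite -[_ *m (c x *m K 0) *m _]mulmxA -[c x *m K 0 *m _]mulmxA K0 !mulmxA.
have := linear_flow_unique h0 hW dM t.
have -> : M 0 = 1%:M by rewrite /M -ss mulKmx // mulmxV.
rewrite expflow_0mx !mul1mx /geo => <-.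
by rewrite /M !mulmxA mulmxV // mul1mx mulmxKV.
Qed.

End Geodesics.

(** * Exponential map and parallel transport in closed form *)

Section Transport.
Context {R : realType} {n : nat}.
Implicit Types (a b P Q A B s W V z p v X D : 'M[R]_n) (t : R).

Lemma sqrtmx_conj_sym p v : spd p -> sym v ->
  sym (invmx (sqrtmx p) *m v *m invmx (sqrtmx p)).
Proof.
by move=> hp hv; apply: sym_congr => //; exact/sym_inv/(proj1 (sqrtmxP hp).1).
Qed.

Lemma geodesic_fromE p v (s := sqrtmx p) : spd p -> sym v ->
  geodesic_from p v = geo s (invmx s *m v *m invmx s).
Proof.
move=> hp hv; have [hs ss] := sqrtmxP hp; rewrite -/s in hs ss.
have us := spd_unit hs; have hW := sqrtmx_conj_sym hp hv; rewrite -/s in hW.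
rewrite /geodesic_from; case: xgetP => [c _ [gc c0 c'0]|none].
  by have [_ ->] := geodesicE gc; rewrite c0 c'0.
case: (none (geo s (invmx s *m v *m invmx s))); split.
- exact: geodesic_geo.
- by rewrite geo0.
- by rewrite derive1_geo // geo_field0 // -!mulmxA mulKVmx // mulVmx // mulmx1.
Qed.

Lemma riem_expE p v t (s := sqrtmx p) : spd p -> sym v ->
  riem_exp p (t *: v) = geo s (invmx s *m v *m invmx s) t.
Proof.
move=> hp hv; have hW := sqrtmx_conj_sym hp hv.
rewrite /riem_exp geodesic_fromE //; last by rewrite /sym linearZ /= hv.
by rewrite /geo -scalemxAr -scalemxAl expflowZ // mulr1.
Qed.

(** The witness comes from whichever geodesic the choice operator selects; the
   transport depends on it only through its flow at time 1. *)
Lemma geodesic_betweenE a b (s := sqrtmx a) : spd a -> spd b ->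
  exists2 W, sym W &
    geodesic_between a b = geo s W /\ expflow W 1 = invmx s *m b *m invmx s.
Proof.
move=> ha hb; have [hs ss] := sqrtmxP ha; rewrite -/s in hs ss.
have us := spd_unit hs.
rewrite /geodesic_between; case: xgetP => [c _ [gc c0 c1]|none].
  have := geodesicE gc; rewrite c0 -/s; move: (_ *m derive1 c 0 *m _) => W [hW cE].
  exists W => //; split=> //; rewrite -c1 cE /geo !mulmxA mulVmx // mul1mx.
  by rewrite -mulmxA mulmxV // mulmx1.
have [W hW WE] := exists_log (spd_sandwich hb (spd_inv hs)).
case: (none (geo s W)); split.
- exact: geodesic_geo.
- by rewrite geo0.
- by rewrite /geo WE -!mulmxA mulKVmx // mulVmx // mulmx1.
Qed.

Lemma parallel_fieldE s W z : spd s -> sym W -> sym z ->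
  parallel_field (geo s W) z = geo_field s W (invmx s *m z *m invmx s).
Proof.
move=> hs hW hz; rewrite /parallel_field; have us := spd_unit hs.
case: xgetP => [V _ [parV V0]|none].
  by rewrite (parallel_geoE hs hW parV) V0.
case: (none (geo_field s W (invmx s *m z *m invmx s))); split.
  apply: parallel_geo_field => //; apply: sym_congr => //.
  exact/sym_inv/(proj1 hs).
by rewrite geo_field0 // -!mulmxA mulKVmx // mulVmx // mulmx1.
Qed.

(** Parallel transport in closed form: the flow at time 1/2 is the positive square
   root of the flow at time 1. *)
Lemma par_transportE a b z (s := sqrtmx a) (r := sqrtmx (invmx s *m b *m invmx s)) :
  spd a -> spd b -> sym z ->
  par_transport a b z = s *m r *m (invmx s *m z *m invmx s) *m r *m s.
Proof.
move=> ha hb hz; have [hs ss] := sqrtmxP ha; rewrite -/s in hs ss.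
have [W hW [gE WE]] := geodesic_betweenE ha hb.
rewrite /par_transport gE parallel_fieldE // /geo_field.
have -> : r = expflow W (2^-1 * 1).
  apply: sqrtmx_unique.
  - exact: expflow_spd.
  - by rewrite expflow_half.
  - exact/spd_sandwich/spd_inv.
by rewrite !mulmxA.
Qed.

End Transport.

(** * The derivative of the square root *)

Section SquareRootDerivative.
Context {R : realType}.
Local Open Scope classical_set_scope.

Lemma cvg_eq (T : Type) (F : set_system T) (f : T -> R) (a b : R) :
  f x @[x --> F] --> a -> a = b -> f x @[x --> F] --> b.
Proof. by move=> fa <-. Qed.

Lemma cvg_sum0 (I T : Type) (F : set_system T) (r : seq I) (f : I -> T -> R) :
  Filter F -> (forall i, f i x @[x --> F] --> 0) ->
  \sum_(i <- r) f i x @[x --> F] --> 0.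
Proof.
move=> FF f0; have := @cvg_big R I +%R 0 xpredT (@add_continuous R) T F r f (fun=> 0) FF.
by rewrite big1 //; apply.
Qed.

Lemma sqnorm_cvg0 (T : Type) (F : set_system T) m n (A : T -> 'M[R]_(m, n)) :
  Filter F -> (forall i j, A x i j @[x --> F] --> 0) ->
  sqnorm (A x) @[x --> F] --> 0.
Proof.
move=> FF A0; under eq_cvg do rewrite sqnormE.
apply: cvg_sum0 => i; apply: cvg_sum0 => j.
under eq_cvg do rewrite expr2.
by have := @cvgM _ _ _ FF _ _ _ _ (A0 i j) (A0 i j); rewrite mulr0.
Qed.

Lemma cvgMr0 (T : Type) (F : set_system T) (g : T -> R) (k : R) : Filter F ->
  g x @[x --> F] --> 0 -> k * g x @[x --> F] --> 0.
Proof.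
move=> FF g0; have kk : k @[_ --> F] --> k by exact: cvg_cst.
by have := @cvgM _ _ _ FF _ _ _ _ kk g0; rewrite mulr0.
Qed.

Lemma entry_cvg0 (T : Type) (F : set_system T) m n (A : T -> 'M[R]_(m, n))
    (g : T -> R) : Filter F ->
  (forall x, sqnorm (A x) <= g x) -> g x @[x --> F] --> 0 ->
  forall i j, A x i j @[x --> F] --> 0.
Proof.
move=> FF Ag g0 i j; apply/cvgrPdist_le => e e0.
near=> x; rewrite sub0r normrN.
rewrite -(@ler_pXn2r _ 2) ?nnegrE ?normr_ge0 ?(ltW e0) // real_normK ?num_real //.
rewrite (le_trans (sqr_le_sqnorm _ _ _)) // (le_trans (Ag x)) //.
rewrite -[leLHS]ger0_norm ?(le_trans (sqnorm_ge0 _) (Ag x)) //.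
rewrite -[g x]opprK normrN -[- g x]sub0r; near: x.
by move/cvgrPdist_le : g0; apply; rewrite exprn_gt0.
Unshelve. all: by end_near. Qed.

Lemma is_derive_cvgP (f : R -> R) (t d : R) :
  is_derive t (1 : R) f d <-> h^-1 * (f (h + t) - f t) @[h --> 0^'] --> d.
Proof.
have E : (fun h : R => h^-1 *: ((f \o shift t) (h *: (1 : R)) - f t)) =
         (fun h => h^-1 * (f (h + t) - f t)).
  by apply/funext => h /=; rewrite [h%:A]mulr1.
split=> [[df <-]|df].
  by move: (df); rewrite /derivable /derive E.
split; first by rewrite /derivable E; apply/cvg_ex; exists d.
by rewrite /derive E; exact: cvg_lim.
Qed.

Lemma increment_cvg0 (f : R -> R) (t d : R) : is_derive t (1 : R) f d ->
  f (h + t) - f t @[h --> 0^'] --> 0.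
Proof.
move=> /is_derive_cvgP df.
have h0 : (fun h : R => h) @ 0^' --> (0 : R) by exact: cvg_within.
have <- : (fun h : R => h * (h^-1 * (f (h + t) - f t))) = fun h => f (h + t) - f t.
  apply/funext => h; have [->|hn0] := eqVneq h 0.
    by rewrite mul0r add0r subrr.
  by rewrite mulrA mulfV // mul1r.
by apply: (cvg_eq (cvgM h0 df)); rewrite mul0r.
Qed.

(** The increment [H] of the square root satisfies a Sylvester equation whose right
   side is the increment of [m], hence tends to 0 by the bound above. The error
   [H / h - X] of the difference quotient satisfies the same equation, with the
   error of the difference quotient of [m] minus [H *m X] on the right, and the
   bound applies once more. *)
Lemma is_derive_sqrtmx n (m : R -> 'M[R]_n) (t : R) D X (r := sqrtmx (m t)) :
  (forall x, spd (m x)) -> is_derive t 1 m D -> r *m X + X *m r = D ->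
  is_derive t 1 (fun x => sqrtmx (m x)) X.
Proof.
move=> hm dm rX.
have hs x : spd (sqrtmx (m x)) /\ sqrtmx (m x) *m sqrtmx (m x) = m x.
  exact: sqrtmxP.
have [c c0 hc] := sylvester_bound (hs t).1.
pose q h := sqrtmx (m (h + t)).
have hq h : spd (q h) by exact: (hs _).1.
have qq h : q h *m q h = m (h + t) by exact: (hs _).2.
have rr : r *m r = m t by exact: (hs _).2.
have dmij i j : h^-1 * (m (h + t) i j - m t i j) @[h --> 0^'] --> D i j.
  exact: (is_derive_cvgP (fun x => m x i j) t _).1 ((is_derive_mxP _ _ _).1 dm i j).
(* The square root is continuous at [t]. *)
have cH i j : (q h - r) i j @[h --> 0^'] --> 0.
  apply: (@entry_cvg0 _ _ _ _ _ (fun h => c^-1 * sqnorm (m (h + t) - m t))).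
    move=> h; rewrite ler_pdivlMl //.
    rewrite (le_trans (hc _ _ (hq h))) // mulmxBr mulmxBl qq rr addrA subrK.
    exact: lexx.
  apply: cvgMr0; apply: sqnorm_cvg0 => k l.
  under eq_cvg do rewrite !mxE.
  exact: increment_cvg0 ((is_derive_mxP _ _ _).1 dm k l).
pose Z h := h^-1 *: (m (h + t) - m t) - D - (q h - r) *m X.
have cZ i j : Z h i j @[h --> 0^'] --> 0.
  have -> : (fun h => Z h i j) = (fun h =>
      h^-1 * (m (h + t) i j - m t i j) - D i j - \sum_k (q h - r) i k * X k j).
    by apply/funext => h; rewrite /Z !mxE.
  have cHX : \sum_k (q h - r) i k * X k j @[h --> 0^'] --> 0.
    apply: cvg_sum0 => k; under eq_cvg do rewrite mulrC.
    exact: cvgMr0.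
  by apply: (cvg_eq (cvgB (cvgB (dmij i j) (cvg_cst (D i j))) cHX)); rewrite subrr subr0.
pose Y h := h^-1 *: (q h - r) - X.
have YZ h : q h *m Y h + Y h *m r = Z h.
  have e1 : q h *m (q h - r) + (q h - r) *m r = m (h + t) - m t.
    by rewrite mulmxBr mulmxBl qq rr addrA subrK.
  have e2 : q h *m X + X *m r = D + (q h - r) *m X.
    by rewrite -rX mulmxBl [RHS]addrC addrA subrK.
  rewrite /Y /Z mulmxBr mulmxBl -scalemxAr -scalemxAl addrACA -scalerDr e1.
  by rewrite -opprD e2 opprD addrA.
have cY i j : Y h i j @[h --> 0^'] --> 0.
  apply: (@entry_cvg0 _ _ _ _ _ (fun h => c^-1 * sqnorm (Z h))).
    by move=> h; rewrite ler_pdivlMl // -YZ; exact: hc.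
  by apply: cvgMr0; exact: sqnorm_cvg0.
apply/is_derive_mxP => i j; apply: (is_derive_cvgP (fun x => sqrtmx (m x) i j) t _).2.
have -> : (fun h => h^-1 * (sqrtmx (m (h + t)) i j - sqrtmx (m t) i j)) =
    (fun h => Y h i j + X i j).
  by apply/funext => h; rewrite /Y !mxE subrK.
by apply: (cvg_eq (cvgD (cY i j) (cvg_cst (X i j)))); rewrite add0r.
Qed.

End SquareRootDerivative.

(** * The covariant derivative of the transported field *)

Theorem lemma4p11 (R : realType) (n : nat) (u u' z v X : 'M[R]_n)
    (* u is u_i and u' is u_{i-1} *)
    (hu : spd u) (hu' : spd u') (hz : sym z) (hv : sym v) :
  let s := sqrtmx u in
  let ubar := invmx s *m u' *m invmx s in
  let zbar := invmx s *m z *m invmx s in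
  let vbar := invmx s *m v *m invmx s in
  let r := sqrtmx ubar in
  let gam := fun t : R => riem_exp u' (t *: v) in
  let B := fun t : R => par_transport u (gam t) z in
  let S := v *m invmx u' *m s *m r *m zbar *m r *m s in
  let T := s *m X *m zbar *m r *m s in
  r *m X + X *m r = vbar ->
  derivable B 0 1 /\
  covderiv gam B 0 = (T - 2^-1 *: S) + (T - 2^-1 *: S)^T.
Proof.
move=> s ubar zbar vbar r gam B S T rX.
have [hs ss] := sqrtmxP hu; rewrite -/s in hs ss.
have [hs' ss'] := sqrtmxP hu'; set s' := sqrtmx u' in hs' ss'.
have us := spd_unit hs; have us' := spd_unit hs'.
pose W := invmx s' *m v *m invmx s'.
have hW : sym W by exact: sqrtmx_conj_sym.
have gamE t : gam t = geo s' W t by exact: riem_expE.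
have gam0 : gam 0 = u' by rewrite gamE geo0.
have sWs : s' *m W *m s' = v by rewrite /W -!mulmxA mulKVmx // mulVmx // mulmx1.
have dgam : is_derive (0 : R) 1 gam v.
  rewrite (_ : gam = geo s' W); last by apply/funext.
  by apply: (is_derive_eq (is_derive_geo s' 0 hW)); rewrite geo_field0.
have gam_spd t : spd (gam t) by rewrite gamE; exact: geo_spd.
pose m t := invmx s *m gam t *m invmx s.
have m_spd t : spd (m t) by exact: spd_sandwich (gam_spd t) (spd_inv hs).
have BE t : B t = s *m sqrtmx (m t) *m zbar *m sqrtmx (m t) *m s.
  exact: par_transportE.
have m0 : m 0 = ubar by rewrite /m gam0.
have dm : is_derive (0 : R) 1 m vbar.
  exact: is_derive_mulmxr (is_derive_mulmxl _ dgam).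
have rX0 : sqrtmx (m 0) *m X + X *m sqrtmx (m 0) = vbar by rewrite m0.
have dr := is_derive_sqrtmx m_spd dm rX0.
have hr : spd r by rewrite /r -m0; exact: (sqrtmxP (m_spd 0)).1.
have hI := sym_inv (proj1 hs).
have vT : vbar^T = vbar by exact: sym_congr.
have symz : zbar^T = zbar by exact: sym_congr.
clearbody zbar vbar.
have symX : X^T = X.
  apply/eqP; rewrite -subr_eq0; apply/eqP/(sylvester_unique hr hr).
  have := congr1 trmx rX; rewrite linearD /= !trmx_mul (proj1 hr) vT addrC => rXT.
  by rewrite mulmxBr mulmxBl addrACA -opprD rXT rX subrr.
have dB : is_derive (0 : R) 1 B
    (s *m X *m zbar *m r *m s + s *m r *m zbar *m X *m s).
  rewrite (_ : B = fun t => s *m sqrtmx (m t) *m zbar *m sqrtmx (m t) *m s); last first.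
    by apply/funext.
  have h := is_derive_mulmxr s (is_derive_mulmx (is_derive_mulmxr zbar
    (is_derive_mulmxl s dr)) dr).
  by apply: (is_derive_eq h); rewrite m0 -/r mulmxDl.
split; first by case: dB.
have B0 : B 0 = s *m r *m zbar *m r *m s by rewrite BE m0.
have symB0 : sym (B 0).
  by rewrite B0 /sym !trmx_mul symz (proj1 hs) (proj1 hr) !mulmxA.
rewrite /covderiv (derive1_eq dB) (derive1_eq dgam) gam0 christoffelE //.
have SE : S = v *m invmx u' *m B 0 by rewrite B0 /S !mulmxA.
have ST : S^T = B 0 *m invmx u' *m v.
  by rewrite SE !trmx_mul symB0 hv trmx_inv (proj1 hu') mulmxA.
have TT : T^T = s *m r *m zbar *m X *m s.
  by rewrite /T !trmx_mul symX symz (proj1 hs) (proj1 hr) !mulmxA.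
have DT : (T - 2^-1 *: S)^T = T^T - 2^-1 *: S^T.
  by rewrite raddfB /=; congr (_ - _); rewrite linearZ.
rewrite DT TT /affine_gamma -SE -ST addrACA -opprD -scalerDr.
by rewrite scaleNr.
Qed.
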